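(* Let the network graph be connected, let $\theta>1$, and couple the step-size to the regularization parameter by $\mu=\eta^{-\theta}$. Assume $\mathcal{H}=I_N\otimes R_u$ (i.e. $R_{u,1}=\dots=R_{u,N}=R_u$) with $R_u\in\mathbb{R}^{M\times M}$ symmetric positive-definite. Then there exists some positive $\underline{\eta}$ such that for all $\eta>\underline{\eta}$ the matrix $\mathcal{B}'=I_{(2N-1)M}-\mu\mathcal{R}'$ is stable, i.e. its spectral radius satisfies $\rho(\mathcal{B}')<1$.
   Context: Graph: $G$ is an undirected graph with nodes $1,\dots,N$ and $E$ edges (self-loops excluded). Its incidence matrix $C\in\mathbb{R}^{E\times N}$ has, in the row of edge $e$, entry $+1$ at the lower-indexed endpoint, $-1$ at the higher-indexed endpoint, and $0$ elsewhere. When $G$ is connected, $C$ has rank $N-1$. Fix a singular value decomposition $C=USV^{T}$ with $U\in\mathbb{R}^{E\times E}$, $V\in\mathbb{R}^{N\times N}$ orthogonal, $V=[\,V_2\ \ \tfrac{1}{\sqrt N}\mathbf 1_N]$, and $S\in\mathbb{R}^{E\times N}$ whose upper-left $(N-1)\times(N-1)$ block $S_2$ is diagonal with the nonzero singular values of $C$, all other entries of $S$ being zero. Put $\mathcal{S}_2=S_2\otimes I_M$, $\mathcal{V}_2=V_2\otimes I_M$, $\mathcal{V}_0=\tfrac{1}{\sqrt N}\mathbf 1_N\otimes I_M$. With $\mathcal{H}=\mathrm{blockdiag}\{R_{u,1},\dots,R_{u,N}\}$, $$\mathcal{R}'=\begin{bmatrix}\mathcal{V}_2^{T}\mathcal{H}\mathcal{V}_2+\eta\,\mathcal{S}_2^{T}\mathcal{S}_2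 & \mathcal{V}_2^{T}\mathcal{H}\mathcal{V}_0 & \mathcal{S}_2^{T}\\ \mathcal{V}_0^{T}\mathcal{H}\mathcal{V}_2 & \frac1N\sum_{k=1}^N R_{u,k} & 0\\ -\mathcal{S}_2 & 0 & 0\end{bmatrix}\in\mathbb{R}^{(2N-1)M\times(2N-1)M}.$$ *)

(* Defs.v *)
From mathcomp Require Import all_boot all_order all_algebra.
From mathcomp Require Import classical_sets reals exp.
From mathcomp Require Import complex mxtens.

Set Implicit Arguments.
Unset Strict Implicit.
Unset Printing Implicit Defensive.

Import Order.TTheory GRing.Theory Num.Theory.

Local Open Scope ring_scope.
Local Open Scope complex_scope.

(* Each undirected edge is stored once, as the pair (lower, higher) of its end
   nodes, so there are no self-loops; the numbering of the edges is arbitrary. *)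
Record graph (N E : nat) := Graph {
  ends : 'I_E -> 'I_N * 'I_N;
  ends_lt : forall e, ((ends e).1 < (ends e).2)%N;
  ends_inj : injective ends
}.

Definition adjacent (N E : nat) (G : graph N E) : rel 'I_N :=
  fun i j => [exists e, (ends G e == (i, j)) || (ends G e == (j, i))].

Definition graph_connected (N E : nat) (G : graph N E) : Prop :=
  forall i j : 'I_N, connect (adjacent G) i j.

Definition incidence_mx (R : pzRingType) (N E : nat) (G : graph N E) :
    'M[R]_(E, N) :=
  \matrix_(e < E, k < N)
    (if k == (ends G e).1 then 1 else if k == (ends G e).2 then -1 else 0).

Definition orthogonal_mx (R : pzRingType) (n : nat) (A : 'M[R]_n) : Prop :=
  A *m A^T = 1%:M /\ A^T *m A = 1%:M.

Definition posdef_mx (R : numDomainType) (n : nat) (A : 'M[R]_n) : Prop :=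
  A^T = A /\ forall x : 'cV[R]_n, x != 0 -> 0 < (x^T *m A *m x) 0 0.

(* The modulus on R[i] is itself R[i]-valued, hence the real part.  The set
   is finite, so the supremum is a maximum (and it is 0 when n = 0). *)
Definition spectral_radius (R : realType) (n : nat) (A : 'M[R]_n) : R :=
  sup [set complex.Re `|z| | z in
    [set z : R[i] | eigenvalue (map_mx (real_complex R) A) z]]%classic.

Definition stable_mx (R : realType) (n : nat) (A : 'M[R]_n) : Prop :=
  spectral_radius A < 1.

(* From here on N = n + 1; written this way, V = [V_2 V_0] is a row_mx. *)

Definition V0_mx (R : rcfType) (n : nat) : 'cV[R]_(n + 1) :=
  const_mx (Num.sqrt (n + 1)%:R)^-1.

(* Upper-left n x n corner diag(s), zero elsewhere; a connected graph has
   n <= E, so nothing is truncated. *)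
Definition S_mx (R : pzRingType) (n E : nat) (s : 'rV[R]_n) :
    'M[R]_(E, n + 1) :=
  \matrix_(i < E, j < n + 1)
    (if i == j :> nat then row_mx s (0 : 'rV_1) 0 j else 0).

Record is_svd (R : rcfType) (n E : nat) (C : 'M[R]_(E, n + 1))
    (U : 'M[R]_E) (V2 : 'M[R]_(n + 1, n)) (s : 'rV[R]_n) : Prop := IsSvd {
  svd_U : orthogonal_mx U;
  svd_V : orthogonal_mx (row_mx V2 (V0_mx R n));
  svd_pos : forall i, 0 < s 0 i;
  svd_eq : C = U *m S_mx E s *m (row_mx V2 (V0_mx R n))^T
}.

Lemma sum_const_ord (N M : nat) : (\sum_(k < N) M)%N = (N * M)%N.
Proof. by rewrite sum_nat_const card_ord. Qed.

Definition blockdiag (R : pzRingType) (N M : nat) (B : 'I_N -> 'M[R]_M) :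
    'M[R]_(N * M) :=
  castmx (sum_const_ord N M, sum_const_ord N M) (\mxdiag_(k < N) B k).

(* The dimension (2N - 1) M is n * M + M + n * M. *)
Definition Rprime (R : rcfType) (n M : nat) (V2 : 'M[R]_(n + 1, n))
    (s : 'rV[R]_n) (Ru : 'I_(n + 1) -> 'M[R]_M) (eta : R) :
    'M[R]_(n * M + M + n * M) :=
  let H : 'M_((n + 1) * M) := blockdiag Ru in
  let cS2 : 'M_(n * M) := diag_mx s *t (1%:M : 'M_M) in
  let cV2 : 'M_((n + 1) * M, n * M) := V2 *t (1%:M : 'M_M) in
  let cV0 : 'M_((n + 1) * M, M) :=
    castmx (erefl _, mul1n M) (V0_mx R n *t (1%:M : 'M_M)) in
  block_mx
    (block_mx (cV2^T *m H *m cV2 + eta *: (cS2^T *m cS2)) (cV2^T *m H *m cV0)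
              (cV0^T *m H *m cV2) ((n + 1)%:R^-1 *: \sum_k Ru k))
    (col_mx cS2^T 0)
    (row_mx (- cS2) 0)
    0.

Definition Bprime (R : rcfType) (n M : nat) (V2 : 'M[R]_(n + 1, n))
    (s : 'rV[R]_n) (Ru : 'I_(n + 1) -> 'M[R]_M) (eta mu : R) :
    'M[R]_(n * M + M + n * M) :=
  1%:M - mu *: Rprime V2 s Ru eta.

(* Main.v *)
Require Import Defs.
From mathcomp Require Import all_boot all_order all_algebra.
From mathcomp Require Import classical_sets reals exp.
From mathcomp Require Import complex mxtens.
From mathcomp Require Import ring lra.

Set Implicit Arguments.
Unset Strict Implicit.
Unset Printing Implicit Defensive.

Import Order.TTheory GRing.Theory Num.Theory.

Local Open Scope ring_scope.

(* With H = I (x) R_u the middle block of R' decouples, so an eigenvalue l of R'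
   is either an eigenvalue of R_u or, taking the Hermitian product of the
   remaining two rows with a left eigenvector (a, c), a root of the real
   quadratic |a|^2 l^2 - (a (I (x) R_u + eta S_2^2) a^* ) l + a S_2^2 a^* = 0.
   For a quadratic A l^2 - P l + Q with positive coefficients, |1 - mu l| < 1
   as soon as mu Q < P and mu P < 2 A (non-real and real roots, respectively).
   These hold once mu < eta and mu eta = eta^(1 - theta) is small. *)

(** * Spectral radius, and roots of a real quadratic *)

(** A supremum of numbers below 1 could equal 1; strictness survives because the eigenvalues are the
    finitely many roots of the characteristic polynomial. *)
Lemma spectral_radius_lt1 (R : realType) (n : nat) (A : 'M[R]_n) :
  (forall z : R[i], eigenvalue (map_mx (real_complex R) A) z ->
     complex.Re `|z| < 1) ->
  spectral_radius A < 1.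
Proof.
move=> A1; pose cA := map_mx (real_complex R) A.
have [rs rsE] := closed_field_poly_normal (char_poly cA).
have eigE z : eigenvalue cA z = (z \in rs).
  rewrite eigenvalue_root_char rsE (monicP (char_poly_monic _)) scale1r.
  by rewrite root_prod_XsubC.
pose t := \big[Num.max/0]_(z <- rs) complex.Re `|z|.
have t1 : t < 1.
  rewrite /t big_seq; apply: bigmax_lt => // z zrs.
  by apply: A1; rewrite eigE.
apply: le_lt_trans t1; rewrite /spectral_radius.
set S := image _ _.
(* With no eigenvalue ([n = 0]) the supremum takes its default value 0, covered by the starting
   value of [t]. *)
have [->|S0] := eqVneq S set0.
  by rewrite sup0; exact: bigmax_ge_id.
apply: ge_sup; first exact/set0P.
move=> _ [z /= zA <-]; rewrite /t.
by apply: le_bigmax_seq => //; rewrite -eigE.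
Qed.

Lemma Re_norm_lt1 (R : realType) (z : R[i]) :
  complex.Re z ^+ 2 + complex.Im z ^+ 2 < 1 -> complex.Re `|z| < 1.
Proof. by move=> z1; rewrite normc_def /= -sqrtr1 ltr_sqrt. Qed.

(** The two equations are the real and imaginary parts of [A l^2 - P l + Q = 0] at [l = al + i be];
    the conclusion is [|1 - mu l|^2 < 1], expanded and divided by [mu]. *)
Lemma quadratic_root_bound (R : realFieldType) (mu A P Q al be : R) :
  0 < mu -> 0 < A -> 0 < P -> 0 < Q -> mu * Q < P -> mu * P < 2 * A ->
  (al ^+ 2 - be ^+ 2) * A - al * P + Q = 0 ->
  2 * al * be * A - be * P = 0 ->
  mu * (al ^+ 2 + be ^+ 2) < 2 * al.
Proof.
move=> mu0 A0 P0 Q0 muQ muP reE imE.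
(* A real root is positive with [al * A <= P]; for a non-real one, [P = 2 al A] and
   [Q = |l|^2 A]. *)
have [be0|be0] := eqVneq be 0.
  subst be.
  have al0 : 0 < al.
    by rewrite -(pmulr_lgt0 _ P0); have := mulr_ge0 (sqr_ge0 al) (ltW A0); lra.
  rewrite expr0n /= addr0 expr2 mulrA ltr_pM2r //.
  rewrite -(ltr_pM2r A0); apply: le_lt_trans muP.
  rewrite -mulrA ler_pM2l //  -(ler_pM2l al0); lra.
have PE : P = 2 * al * A by apply: (mulfI be0); lra.
rewrite -(ltr_pM2r A0) -PE; apply: le_lt_trans muQ.
by rewrite -mulrA ler_pM2l //; subst P; lra.
Qed.

(** * Real quadratic forms on row vectors *)

Definition qform (R : pzRingType) (n : nat) (B : 'M[R]_n) (x : 'rV[R]_n) : R :=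
  (x *m B *m x^T) 0 0.

(** A crude substitute for the operator norm: any constant bounding the form uniformly in the vector
    would do. *)
Definition entry_sum (R : numDomainType) (n : nat) (B : 'M[R]_n) : R :=
  \sum_i \sum_j `|B i j|.

Lemma qform1 (R : comPzRingType) (n : nat) (x : 'rV[R]_n) :
  qform 1%:M x = \sum_j x 0 j ^+ 2.
Proof.
by rewrite /qform mulmx1 mxE; apply: eq_bigr => j _; rewrite mxE expr2.
Qed.

Lemma qformE (R : pzRingType) (n : nat) (B : 'M[R]_n) (x : 'rV[R]_n) :
  qform B x = \sum_j \sum_i x 0 i * B i j * x 0 j.
Proof.
rewrite /qform mxE; apply: eq_bigr => j _.
by rewrite !mxE mulr_suml; apply: eq_bigr => i _.
Qed.

Lemma qform1_ge0 (R : realDomainType) (n : nat) (x : 'rV[R]_n) :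
  0 <= qform 1%:M x.
Proof. by rewrite qform1; apply: sumr_ge0 => j _; exact: sqr_ge0. Qed.

Lemma qform1_eq0 (R : realDomainType) (n : nat) (x : 'rV[R]_n) :
  (qform 1%:M x == 0) = (x == 0).
Proof.
rewrite qform1 psumr_eq0 => [|j _]; last exact: sqr_ge0.
apply/allP/eqP => [x0|-> j _]; last by rewrite mxE expr0n /= eqxx.
apply/rowP => j; have := x0 j (mem_index_enum _).
by rewrite mxE /= sqrf_eq0 => /eqP.
Qed.

Lemma qform_gram (R : comPzRingType) (n m : nat) (D : 'M[R]_(m, n))
    (x : 'rV[R]_n) :
  qform (D^T *m D) x = qform 1%:M (x *m D^T).
Proof. by rewrite /qform mulmx1 trmx_mul trmxK !mulmxA. Qed.

Lemma qform_lincomb (R : comPzRingType) (n : nat) (A B : 'M[R]_n) (c : R)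
    (x : 'rV[R]_n) :
  qform (A + c *: B) x = qform A x + c * qform B x.
Proof. by rewrite /qform mulmxDr mulmxDl -scalemxAr -scalemxAl !mxE. Qed.

Lemma qform_le (R : realFieldType) (n : nat) (B : 'M[R]_n) (x : 'rV[R]_n) :
  qform B x <= entry_sum B * qform 1%:M x.
Proof.
rewrite qformE exchange_big /= /entry_sum mulr_suml; apply: ler_sum => i _.
rewrite mulr_suml; apply: ler_sum => j _.
have xle k : x 0 k ^+ 2 <= qform 1%:M x.
  by rewrite qform1 (bigD1 k) //= lerDl; apply: sumr_ge0 => l _; exact: sqr_ge0.
apply: le_trans (ler_norm _) _; rewrite !normrM mulrAC mulrC.
rewrite ler_wpM2l //.
have := xle i; have := xle j; rewrite -(real_normK (num_real (x 0 i))).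
rewrite -(real_normK (num_real (x 0 j))).
(* Since [2 |x_i| |x_j| <= x_i^2 + x_j^2], each product [|x_i| |x_j|] is at most [|x|^2]. *)
have := sqr_ge0 (`|x 0 i| - `|x 0 j|); nra.
Qed.

(** * Hermitian forms of real matrices on complex vectors *)

(** For symmetric [B] this is the Hermitian form [a B a^*], kept in [R] so that the order of [R]
    applies. *)
Definition hform (R : rcfType) (n : nat) (B : 'M[R]_n) (a : 'rV[R[i]]_n) : R :=
  qform B (map_mx (@complex.Re R) a) + qform B (map_mx (@complex.Im R) a).

(** With [a = x + i y], the imaginary part of [a B a^*] is [y B x^T - x B y^T], which vanishes by
    symmetry. *)
Lemma qform_real_complex (R : rcfType) (n : nat) (B : 'M[R]_n)
    (a : 'rV[R[i]]_n) : B^T = B ->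
  (a *m map_mx (real_complex R) B *m (map_mx conjc a)^T) 0 0
    = real_complex R (hform B a).
Proof.
move=> Bsym; set x := map_mx (@complex.Re R) a.
set y := map_mx (@complex.Im R) a.
have aE : a = map_mx (real_complex R) x + 'i%C *: map_mx (real_complex R) y.
  by apply/matrixP => i j; rewrite !mxE -complexE.
have acE : map_mx conjc a =
    map_mx (real_complex R) x - 'i%C *: map_mx (real_complex R) y.
  by apply/matrixP => i j; rewrite !mxE; case: (a i j) => u v; simpc.
have yxE : y *m B *m x^T = x *m B *m y^T.
  have tr11 (X : 'M[R]_1) : X^T = X.
    by apply/matrixP => i j; rewrite mxE !ord1.
  by rewrite -[LHS]tr11 !trmx_mul trmxK Bsym mulmxA.
rewrite acE {1}aE /hform -/x -/y; clearbody x y.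
rewrite linearB linearZ /= !map_trmx.
rewrite mulmxBr !mulmxDl -!scalemxAl -!scalemxAr -!map_mxM yxE.
rewrite rmorphD /qform !mxE mulrA -expr2 sqr_i mulN1r.
by ring.
Qed.

Lemma hform_lincomb (R : rcfType) (n : nat) (A B : 'M[R]_n) (c : R)
    (a : 'rV[R[i]]_n) :
  hform (A + c *: B) a = hform A a + c * hform B a.
Proof. by rewrite /hform !qform_lincomb mulrDr addrACA. Qed.

Lemma hform_le (R : rcfType) (n : nat) (B : 'M[R]_n) (a : 'rV[R[i]]_n) :
  hform B a <= entry_sum B * hform 1%:M a.
Proof. by rewrite mulrDr lerD // qform_le. Qed.

Lemma hform_ge0 (R : rcfType) (n : nat) (B : 'M[R]_n) (a : 'rV[R[i]]_n) :
  (forall x, 0 <= qform B x) -> 0 <= hform B a.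
Proof. by move=> B0; rewrite addr_ge0. Qed.

Lemma hform_gt0 (R : rcfType) (n : nat) (B : 'M[R]_n) (a : 'rV[R[i]]_n) :
  (forall x, x != 0 -> 0 < qform B x) -> a != 0 -> 0 < hform B a.
Proof.
move=> B0 a0.
have Bge0 x : 0 <= qform B x.
  have [->|/B0/ltW //] := eqVneq x 0.
  by rewrite /qform !mul0mx mxE.
rewrite lt_neqAle hform_ge0 // andbT eq_sym /hform paddr_eq0 //.
have eq0 x : qform B x == 0 -> x = 0.
  by have [//|/B0/gt_eqF->] := eqVneq x 0.
apply: contra_neqN a0 => /andP[/eq0 /rowP re0 /eq0 /rowP im0].
apply/rowP => j; have := re0 j; have := im0 j; rewrite !mxE.
by case: (a 0 j) => u v /= -> ->.
Qed.

Lemma hform1_gt0 (R : rcfType) (n : nat) (a : 'rV[R[i]]_n) :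
  a != 0 -> 0 < hform 1%:M a.
Proof.
by apply: hform_gt0 => x x0; rewrite lt_neqAle qform1_ge0 eq_sym qform1_eq0 x0.
Qed.

(** As [D] is real, the form is [|a D^T|^2], and [a D^T] is nonzero by invertibility. *)
Lemma hform_gram_gt0 (R : rcfType) (n : nat) (D : 'M[R]_n)
    (a : 'rV[R[i]]_n) :
  D \in unitmx -> a != 0 -> 0 < hform (D^T *m D) a.
Proof.
move=> Du a0.
have -> : hform (D^T *m D) a = hform 1%:M (a *m map_mx (real_complex R) D^T).
  rewrite /hform !qform_gram; congr (_ + _); congr (qform _ _);
    apply/matrixP => i j; rewrite !mxE raddf_sum; apply: eq_bigr => k _;
    by rewrite !mxE; case: (a i k) => u v /=;
      rewrite !(mulr0, subr0, add0r, addr0).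
apply: hform1_gt0; apply: contra_neq a0 => aD0.
have DTu : map_mx (real_complex R) D^T \in unitmx.
  by rewrite map_unitmx unitmx_tr.
by rewrite -[a](mulmxK DTu) aD0 mul0mx.
Qed.

(** * Spectrum and stability of saddle-point matrices *)

Lemma eigenvalue_sub_scale (F : fieldType) (n : nat) (A : 'M[F]_n) (c z : F) :
  c != 0 -> eigenvalue (1%:M - c *: A) z -> eigenvalue A ((1 - z) / c).
Proof.
move=> c0 /eigenvalueP[v vE v0]; apply/eigenvalueP; exists v => //.
apply: (scalerI c0); rewrite scalerA mulrCA mulfV // mulr1 scalerBl scale1r -vE.
by rewrite mulmxBr mulmx1 -scalemxAr opprB addrC subrK.
Qed.

(** The shape of [Rprime] once its middle block decouples, with [Q] being R_u and [D] being S_2 (x)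
    I. *)
Definition saddle_mx (R : pzRingType) (p m : nat) (P D : 'M[R]_p) (Q : 'M[R]_m)
    : 'M[R]_(p + m + p) :=
  block_mx (block_mx P 0 0 Q) (col_mx D^T 0) (row_mx (- D) 0) 0.

(* Left eigenvectors (a, b, c) are eigenvectors b of Q, or have b = 0, in
   which case eliminating c through a D^T = l c gives the quadratic. *)
Lemma saddle_eigenvalue (R : rcfType) (p m : nat) (P D : 'M[R]_p)
    (Q : 'M[R]_m) (l : R[i]) :
  P^T = P -> Q^T = Q -> D \in unitmx ->
  eigenvalue (map_mx (real_complex R) (saddle_mx P D Q)) l ->
  (exists2 b : 'rV[R[i]]_m, b != 0 &
     l * real_complex R (hform 1%:M b) = real_complex R (hform Q b)) \/
  (exists2 a : 'rV[R[i]]_p, a != 0 &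
     l ^+ 2 * real_complex R (hform 1%:M a)
       - l * real_complex R (hform P a)
       + real_complex R (hform (D^T *m D) a) = 0).
Proof.
move=> Psym Qsym Du /eigenvalueP[v].
rewrite -[v]hsubmxK -[lsubmx v]hsubmxK; move: (rsubmx v) (lsubmx v) => c ab {v}.
move: (lsubmx ab) (rsubmx ab) => a b {ab}.
rewrite /saddle_mx map_block_mx map_block_mx map_col_mx map_row_mx !map_mx0.
rewrite mul_row_block mul_row_block mul_row_col mul_mx_row !mulmx0 !addr0 add0r.
rewrite add_row_mx addr0 !scale_row_mx => /eq_row_mx[/eq_row_mx[aE bE] cE] v0.
have [b0|b0] := eqVneq b 0; [right|left; exists b => //]; last first.
  rewrite -(qform_real_complex _ Qsym) bE -!scalemxAl mxE.
  by rewrite -qform_real_complex ?trmx1 // map_mx1 mulmx1.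
exists a.
  apply: contraNneq v0 => a0; rewrite a0 b0.
  move: aE; rewrite a0 mul0mx scaler0 add0r raddfN /= mulmxN => /eqP.
  rewrite oppr_eq0 => /eqP cD.
  have Du' : map_mx (real_complex R) D \in unitmx by rewrite map_unitmx.
  by rewrite -[c](mulmxK Du') cD mul0mx !row_mx0.
have DDsym : (D^T *m D)^T = D^T *m D by rewrite trmx_mul trmxK.
rewrite -(qform_real_complex _ Psym) -(qform_real_complex _ DDsym).
rewrite -qform_real_complex ?trmx1 // map_mx1 mulmx1 map_mxM mulmxA cE.
(* After this substitution the terms [l c D a^*] cancel, the last one coming from [a D^T = l c]. *)
have -> : a *m map_mx (real_complex R) P
    = l *: a + c *m map_mx (real_complex R) D.
  by rewrite -aE raddfN /= mulmxN subrK.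
rewrite mulmxDl -!scalemxAl !mxE.
by ring.
Qed.

(** The [eta] term of the upper block makes [mu < eta] yield [mu Q < P] for the quadratic; the
    bounds by [entry_sum] yield [mu P < 2 A] and handle the eigenvalues of the block [Q]. *)
Lemma saddle_stable (R : realType) (p m : nat) (P D : 'M[R]_p) (Q : 'M[R]_m)
    (eta mu : R) :
  P^T = P -> (forall x, 0 <= qform P x) -> D \in unitmx ->
  Q^T = Q -> (forall x, x != 0 -> 0 < qform Q x) ->
  0 < mu -> mu < eta ->
  mu * (entry_sum P + eta * entry_sum (D^T *m D)) < 2 ->
  mu * entry_sum Q < 2 ->
  stable_mx (1%:M - mu *: saddle_mx (P + eta *: (D^T *m D)) D Q).
Proof.
move=> Psym P0 Du Qsym Q0 mu0 mueta muP muQ; apply: spectral_radius_lt1 => z.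
have muC0 : real_complex R mu != 0 by rewrite fmorph_eq0 gt_eqF.
rewrite map_mxB map_mx1 map_mxZ => /(eigenvalue_sub_scale muC0).
set l := _ / _ => eigl.
have zE : z = 1 - real_complex R mu * l by rewrite mulrCA divff // mulr1 subKr.
have Psym' : (P + eta *: (D^T *m D))^T = P + eta *: (D^T *m D).
  by rewrite linearD linearZ /= Psym trmx_mul trmxK.
suff: mu * (complex.Re l ^+ 2 + complex.Im l ^+ 2) < 2 * complex.Re l.
  move=> llt; apply: Re_norm_lt1; move: llt; rewrite zE.
  case: (l) => al be; simpc; rewrite -(ltr_pM2l mu0) /= => llt.
  by lra.
have [[b b0]|[a a0]] := saddle_eigenvalue Psym' Qsym Du eigl.
  have h0 := hform_gt0 Q0 b0.
  have := hform1_gt0 b0; have := hform_le Q b.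
  set r := hform Q b in h0 *; set A := hform 1%:M b => rle A0.
  (* Both forms are real and positive, so [l] is a positive real, at most [entry_sum Q]. *)
  case: (l) => al be; simpc => -[alE /eqP] /=.
  rewrite mulf_eq0 (gt_eqF A0) orbF => /eqP->.
  have al0 : 0 < al by rewrite -(pmulr_lgt0 _ A0) alE.
  rewrite expr0n /= addr0 expr2 mulrA ltr_pM2r // -(ltr_pM2r A0) -mulrA alE.
  apply: le_lt_trans (_ : mu * (entry_sum Q * A) < _).
    by rewrite ler_pM2l.
  by rewrite mulrA ltr_pM2r.
have DD0 := hform_gram_gt0 Du a0; have A0 := hform1_gt0 a0.
have PP0 := hform_ge0 a P0.
have Ple := hform_le P a; have DDle := hform_le (D^T *m D) a.
rewrite hform_lincomb.
case: (l) => al be; rewrite expr2 /real_complex_def; simpc => -[reE imE] /=.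
have eta0 := lt_trans mu0 mueta.
set h := hform P a in PP0 Ple reE imE *.
set d := hform _ a in DD0 DDle reE imE *.
have etad0 : 0 < eta * d by rewrite mulr_gt0.
apply: (@quadratic_root_bound _ mu (hform 1%:M a) (h + eta * d) d) => //.
- by lra.
- by have : mu * d < eta * d; [rewrite ltr_pM2r|lra].
- apply: le_lt_trans (_ : mu * ((entry_sum P + eta * entry_sum (D^T *m D))
      * hform 1%:M a) < _); last by rewrite mulrA ltr_pM2r.
  by rewrite ler_pM2l // mulrDl lerD // -mulrA ler_pM2l.
- by rewrite -imE; ring.
Qed.

(** * Kronecker products and the reduction of [Rprime] *)

Lemma big_mxtens_index (V : nmodType) (n m : nat) (F : 'I_(n * m) -> V) :
  \sum_i F i = \sum_(k < n) \sum_(l < m) F (mxtens_index (k, l)).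
Proof.
have bij : bijective (@mxtens_index n m).
  by exists (@mxtens_unindex n m);
    [exact: mxtens_indexK|exact: mxtens_unindexK].
rewrite (reindex _ (onW_bij _ bij)) pair_bigA.
by apply: eq_bigr => -[].
Qed.

(** Cutting [x] into [n] blocks of length [m] turns the form into a sum of values of [qform B]. *)
Lemma qform_tens1_ge0 (R : numDomainType) (n m : nat) (B : 'M[R]_m)
    (x : 'rV[R]_(n * m)) :
  (forall y, 0 <= qform B y) -> 0 <= qform ((1%:M : 'M_n) *t B) x.
Proof.
move=> B0; pose y k : 'rV[R]_m := \row_j x 0 (mxtens_index (k, j)).
suff -> : qform ((1%:M : 'M_n) *t B) x = \sum_k qform B (y k).
  by apply: sumr_ge0.
rewrite qformE big_mxtens_index; apply: eq_bigr => k _.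
rewrite qformE; apply: eq_bigr => l _; rewrite big_mxtens_index.
rewrite (bigD1 k) //= [X in _ + X]big1 ?addr0 => [|k' /negPf k'k].
  by apply: eq_bigr => l' _; rewrite tensmxE !mxE eqxx mul1r.
by rewrite big1 // => l' _; rewrite tensmxE mxE k'k mul0r mulr0 mul0r.
Qed.

(** Needed for the averaged block of [Rprime], which involves the individual R_{u,k} and not their
    block diagonal matrix. *)
Lemma blockdiag_eq_tens1mx (R : pzRingType) (n m : nat) (B : 'I_n -> 'M[R]_m)
    (A : 'M[R]_m) :
  blockdiag B = (1%:M : 'M_n) *t A -> forall k, B k = A.
Proof.
move=> BA k; rewrite -[LHS](submxblock_diag (p_ := fun=> m)).
have -> : \mxdiag_k B k
    = castmx (esym (sum_const_ord n m), esym (sum_const_ord n m)) (1%:M *t A).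
  by rewrite -BA castmxK.
apply/matrixP => i j; rewrite mxE castmxE !esymK.
(* Both indexings place entry [l] of block [k] at position [k * m + l]. *)
have RankE (l : 'I_m) : cast_ord (sum_const_ord n m)
    (tagnat.Rank k l) = mxtens_index (k, l).
  apply: val_inj; rewrite [LHS]tagnat.RankEsum /=; congr (_ + _)%N.
  by rewrite -(big_ord_widen n (fun=> m) (ltnW (ltn_ord k))) sum_const_ord.
by rewrite !RankE tensmxE mxE eqxx mul1r.
Qed.

Lemma castmx_mul_eq0 (R : pzRingType) (m m' n p : nat) (e : m = m')
    (A : 'M[R]_(m, n)) (B : 'M[R]_(n, p)) :
  A *m B = 0 -> castmx (e, erefl) A *m B = 0.
Proof. by case: _ / e. Qed.

Lemma mul_castmx_eq0 (R : pzRingType) (m n p p' : nat) (e : p = p')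
    (A : 'M[R]_(m, n)) (B : 'M[R]_(n, p)) :
  A *m B = 0 -> A *m castmx (erefl, e) B = 0.
Proof. by case: _ / e. Qed.

Lemma orthogonal_row_mx (R : pzRingType) (n p q : nat) (A : 'M[R]_(n, p))
    (B : 'M[R]_(n, q)) :
  (row_mx A B)^T *m row_mx A B = 1%:M ->
  [/\ A^T *m A = 1%:M, A^T *m B = 0 & B^T *m B = 1%:M].
Proof.
rewrite tr_row_mx mul_col_row scalar_mx_block.
by case/eq_block_mx => -> -> _ ->.
Qed.

(** By the mixed-product rule the blocks of H become [V_i^T V_j] (x) R_u, and orthonormality of the
    columns of V removes the cross blocks. *)
Lemma Rprime_saddle (R : rcfType) (n m : nat) (V2 : 'M[R]_(n + 1, n))
    (s : 'rV[R]_n) (Ruk : 'I_(n + 1) -> 'M[R]_m) (Ru : 'M[R]_m) (eta : R) :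
  orthogonal_mx (row_mx V2 (V0_mx R n)) ->
  blockdiag Ruk = (1%:M : 'M_(n + 1)) *t Ru ->
  let D := diag_mx s *t (1%:M : 'M_m) in
  Rprime V2 s Ruk eta
    = saddle_mx ((1%:M : 'M_n) *t Ru + eta *: (D^T *m D)) D Ru.
Proof.
move=> [_ /orthogonal_row_mx[V22 V20 _]] RukE D.
rewrite /Rprime /saddle_mx RukE -/D.
have V02 : (V0_mx R n)^T *m V2 = 0.
  by rewrite -[LHS]trmxK trmx_mul trmxK V20 trmx0.
congr (block_mx (block_mx (_ + _) _ _ _) _ _ _).
- by rewrite trmx_tens trmx1 !tensmx_mul mulmx1 V22 mul1mx mulmx1.
- apply: mul_castmx_eq0.
  by rewrite trmx_tens trmx1 !tensmx_mul mulmx1 mul1mx mulmx1 V20 tens0mx.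
- rewrite trmx_cast /= -mulmxA; apply: castmx_mul_eq0.
  by rewrite trmx_tens trmx1 !tensmx_mul mul1mx !mulmx1 mul1mx V02 tens0mx.
- rewrite (eq_bigr (fun=> Ru)) => [|k _]; last exact: blockdiag_eq_tens1mx RukE k.
  rewrite sumr_const card_ord -scaler_nat scalerA mulVf ?scale1r //.
  by rewrite pnatr_eq0 addn1.
Qed.

Lemma tens11mx (R : pzRingType) (n m : nat) :
  (1%:M : 'M[R]_n) *t (1%:M : 'M_m) = 1%:M.
Proof.
apply/matrixP => i j.
case: (mxtens_indexP i) => k a; case: (mxtens_indexP j) => l b.
rewrite tensmxE !mxE.
by rewrite (can_eq (@mxtens_indexK _ _)) xpair_eqE -natrM mulnb.
Qed.

Lemma unitmx_diag_tens1 (F : fieldType) (n m : nat) (s : 'rV[F]_n) :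
  (forall i, s 0 i != 0) -> diag_mx s *t (1%:M : 'M_m) \in unitmx.
Proof.
move=> s0.
have su : diag_mx s \in unitmx.
  by rewrite unitmxE det_diag unitfE; apply/prodf_neq0 => i _.
suff /mulmx1_unit[] : (diag_mx s *t (1%:M : 'M_m))
    *m (invmx (diag_mx s) *t (1%:M : 'M_m)) = 1%:M by [].
by rewrite tensmx_mul mulmx1 mulmxV // tens11mx.
Qed.

(** * Choice of the threshold for the regularization parameter *)

Lemma posdef_qform_gt0 (R : numDomainType) (n : nat) (B : 'M[R]_n)
    (x : 'rV[R]_n) :
  posdef_mx B -> x != 0 -> 0 < qform B x.
Proof.
move=> [_ B0] x0; rewrite /qform -{1}[x]trmxK; apply: B0.
by rewrite trmx_eq0.
Qed.

Lemma entry_sum_ge0 (R : numDomainType) (n : nat) (B : 'M[R]_n) :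
  0 <= entry_sum B.
Proof. by do 2!apply: sumr_ge0 => ? _. Qed.

Theorem theorem6 (R : realType) (n E M : nat) (G : graph (n + 1) E)
    (U : 'M[R]_E) (V2 : 'M[R]_(n + 1, n)) (s : 'rV[R]_n)
    (Ruk : 'I_(n + 1) -> 'M[R]_M) (Ru : 'M[R]_M) (theta : R)
    (Gconn : graph_connected G)
    (Csvd : is_svd (incidence_mx R G) U V2 s)
    (theta_gt1 : 1 < theta)
    (Hkron : blockdiag Ruk = (1%:M : 'M[R]_(n + 1)) *t Ru)
    (Ru_pos : posdef_mx Ru) :
  exists eta0 : R, 0 < eta0 /\
    forall eta : R, eta0 < eta ->
      stable_mx (Bprime V2 s Ruk eta (eta `^ (- theta))).
Proof.
have [_ Vorth s_gt0 _] := Csvd.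
pose D := diag_mx s *t (1%:M : 'M_M); pose P := (1%:M : 'M_n) *t Ru.
pose kP := entry_sum P; pose kD := entry_sum (D^T *m D).
pose kQ := entry_sum Ru.
have kP0 : 0 <= kP := entry_sum_ge0 _.
have kD0 : 0 <= kD := entry_sum_ge0 _.
have kQ0 : 0 <= kQ := entry_sum_ge0 _.
(* One constant for all the smallness conditions: each will follow from [mu * eta * K < 1]. *)
pose K := 1 + kP + kD + kQ; have K1 : 1 <= K by rewrite /K; lra.
have K0 : 0 < K by lra.
have th0 : 0 < theta - 1 by rewrite subr_gt0.
have root0 : 0 <= K `^ (theta - 1)^-1 := powR_ge0 _ _.
(* The summand 1 gives [eta > 1], hence [mu <= mu * eta]; the power gives [eta^(theta - 1) > K],
   which is [mu * eta * K < 1] because [mu * eta = eta^(1 - theta)]. *)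
exists (1 + K `^ (theta - 1)^-1); split=> [|eta eta_gt]; first by lra.
have eta1 : 1 < eta by lra.
have root_lt : K `^ (theta - 1)^-1 < eta by lra.
have eta_gt0 : 0 < eta by lra.
set mu := eta `^ (- theta).
have mu0 : 0 < mu by exact: powR_gt0.
have muK : mu * eta * K < 1.
  have Klt : K < eta `^ (theta - 1).
    have <- : (K `^ (theta - 1)^-1) `^ (theta - 1) = K.
      by rewrite -powRrM mulVf ?gt_eqF // powRr1 // ltW.
    by apply: gt0_ltr_powR; rewrite ?nnegrE ?powR_ge0 ?ltW.
  have muE : mu * eta = (eta `^ (theta - 1))^-1.
    rewrite /mu -powRN opprB addrC powRD ?(gt_eqF eta_gt0) ?implybT //.
    by rewrite powRr1 ?ltW.
  by rewrite muE mulrC ltr_pdivrMr ?mul1r // powR_gt0.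
have mule x : 0 <= x -> mu * x <= mu * eta * x.
  by move=> x0; rewrite ler_wpM2r // ler_peMr // ltW.
have mueta0 : 0 < mu * eta by rewrite mulr_gt0.
have [RuT _] := Ru_pos.
have mE : mu * eta * K
    = mu * eta + mu * eta * kP + mu * eta * kD + mu * eta * kQ.
  by rewrite /K; ring.
have := mule _ kP0; have := mule _ kQ0; have := mule 1 ler01.
have := mulr_ge0 (ltW mueta0) kP0; have := mulr_ge0 (ltW mueta0) kQ0.
have := mulr_ge0 (ltW mueta0) kD0 => meD meQ meP me1 mQ mP.
rewrite /Bprime (Rprime_saddle _ _ Vorth Hkron); apply: saddle_stable => //.
- by rewrite trmx_tens trmx1 RuT.
- move=> x; apply: qform_tens1_ge0 => y.
  have [->|y0] := eqVneq y 0; first by rewrite /qform !mul0mx mxE.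
  by rewrite ltW // posdef_qform_gt0.
- by apply: unitmx_diag_tens1 => i; rewrite gt_eqF.
- by move=> x; exact: posdef_qform_gt0.
(* Here [mu <= mu * eta < 1 < eta]. *)
- by rewrite mulr1 in me1; lra.
- by rewrite mulrDr mulrA -/P -/D -/kP -/kD; lra.
- by rewrite -/kQ; lra.
Qed.
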